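(* Let $1\le p<\infty$ and let $\Lambda=(\lambda_k)_k\subset\mathbb{R}^+$ be a strictly increasing infinite sequence with $\sum_k\frac{1}{\lambda_k}<\infty$ satisfying the gap condition $\inf_k(\lambda_{k+1}-\lambda_k)>0$. If $\phi(x)=\alpha x^{\zeta_1}+\beta x^{\zeta_2}$ with $\alpha,\beta\in\mathbb{R}\setminus\{0\}$, $\zeta_1<\zeta_2$ in $\mathbb{R}^+$, and $\phi([0,1])\subset[0,1]$, then $C_\phi M^p_\Lambda\nsubseteq M^p_\Lambda$.
   Context: $\mathbb{R}^+=(0,\infty)$. $L^p=L^p([0,1])$ with respect to Lebesgue measure. The Müntz space $M^p_\Lambda$ is the closed linear span of $\{x^{\lambda}:\lambda\in\Lambda\}$ in $L^p$; its elements are (represented by) functions continuous on $[0,1)$. The composition operator is $C_\phi f=f\circ\phi$. The relation $C_\phi M^p_\Lambda\nsubseteq M^p_\Lambda$ means that there is $f\in M^p_\Lambda$ with $f\circ\phi\notin M^p_\Lambda$. *)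

(* Defs.v *)
From HB Require Import structures.
From mathcomp Require Import all_boot all_order all_algebra.
From mathcomp Require Import all_classical all_reals all_analysis.

Set Implicit Arguments.
Unset Strict Implicit.
Unset Printing Implicit Defensive.

Import Order.TTheory GRing.Theory Num.Theory.
Import numFieldNormedType.Exports.

Local Open Scope classical_set_scope.
Local Open Scope ring_scope.

(* L^p([0,1]) is handled through representatives f : R -> R, of which only the
   restriction to [0,1] matters: [f \_ `[0, 1]] is f on [0,1] and 0 elsewhere. *)
Definition Lp01 (R : realType) (p : R) : set (R -> R) :=
  [set f | f \_ `[0, 1] \in Lfun (@lebesgue_measure R) p%:E].

Definition Lp01_norm (R : realType) (p : R) (f : R -> R) : \bar R :=
  Lnorm (@lebesgue_measure R) p%:E (EFin \o (f \_ `[0, 1])).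

Definition monomial_span (R : realType) (Lambda : set R) : set (R -> R) :=
  [set g | exists (n : nat) (c l : 'I_n -> R),
     (forall i, Lambda (l i)) /\ g = (fun x => \sum_(i < n) c i * x `^ l i)].

(* The closure of the span in the L^p norm. Membership is invariant under
   almost-everywhere equality on [0,1]. *)
Definition muntz_space (R : realType) (p : R) (Lambda : set R) :
    set (R -> R) :=
  [set f | Lp01 p f /\
     forall e : R, 0 < e ->
       exists2 g, monomial_span Lambda g & (Lp01_norm p (f \- g)%R < e%:E)%E].

Definition comp_op (R : realType) (phi f : R -> R) : R -> R := f \o phi.

(* C_phi M is not contained in M. The witness is the representative continuous
   on [0,1[, so that f \o phi is a definite function off the set phi = 1. *)
Definition comp_op_not_stable (R : realType) (p : R) (Lambda : set R)
    (phi : R -> R) : Prop :=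
  exists f : R -> R,
    [/\ muntz_space p Lambda f,
        {within `[0, 1[, continuous f} &
        ~ muntz_space p Lambda (comp_op phi f)].

(* Main.v *)
Require Import Defs.
From HB Require Import structures.
From mathcomp Require Import all_boot all_order all_algebra.
From mathcomp Require Import all_classical all_reals all_analysis.
From mathcomp Require Import measurable_realfun ring lra.

Import Order.TTheory GRing.Theory Num.Theory.
Import numFieldNormedType.Exports.

Local Open Scope classical_set_scope.
Local Open Scope ring_scope.

(** Suppose C_phi maps M^p_Lambda into itself, and apply it to a monomial
x^lambda with lambda in Lambda. Near 0, with delta = zeta2 - zeta1, the
binomial series gives
  phi(x)^lambda = sum_j b_j x^(zeta1 lambda + j delta),
  b_j = alpha^lambda binom(lambda, j) (beta / alpha)^j,
where alpha > 0 because phi >= 0, and b_j <> 0 for every j <= lambda. An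
element of M^p_Lambda can only have exponents of Lambda in such an expansion
(muntz_leading_coef), so Lambda contains the numbers zeta1 lambda + j delta for
all integers j <= lambda. These are more than lambda numbers, none exceeding
(zeta1 + delta) lambda, so their reciprocals add up to at least
1 / (zeta1 + delta). Since lambda may be taken as large as one wishes, the
partial sums of the series of reciprocals are not Cauchy
(progressions_not_summable).

The analytic core is the claim about exponents. If mu is not in Lambda, the
coefficient of x^mu in an element of span {x^mu, x^l : l in Lambda} is bounded
by a multiple of its L^1 norm (muntz_coef_bound). The proof is algebraic: the
squared L^2 norm of a combination of powers is a quadratic form with a Cauchy
matrix, 1 / (s_i + s_j), which does not increase when each coefficient c_i is
multiplied by (s_i - t) / (s_i + t) (cauchy_form_blaschke). Letting t run
through the exponents other than mu kills all the terms but one, at the price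
of a product that the convergence of the series of reciprocals keeps away from
zero. A primitive turns L^1 norms into sup norms, which dominate L^2 norms,
and L^p norms on [0, 1] dominate L^1 norms.

To get the claim on exponents from this bound, let F in M^p_Lambda agree with
sum_(i <= J) b_i x^(mu_i) up to O(x^nu) near 0, where nu > mu_J, the exponents
mu_i with i < J are in Lambda and mu_J is not. Let P be a combination of
powers x^l, l in Lambda, within e of F in norm. The coefficient of x^(mu_J) in
P minus the expansion is - b_J, and on [0, r] the L^1 norm of this difference
is at most e + O(r^(nu + 1)). Rescaling [0, r] to [0, 1] gives |b_J| r^(mu_J +
1) <= K (e + C r^(nu + 1)). Letting e tend to 0, then r, yields b_J = 0. *)

(** * The Cauchy quadratic form *)

(** The square of the L^2([0, 1]) norm of sum_i c_i x^(s_i - 1/2). *)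
Definition cauchy_form {R : realType} {I : finType} (c s : I -> R) : R :=
  \sum_i \sum_j c i * c j / (s i + s j).

(** The operator taking x^s to (s - t) / (s + t) x^s is an isometry of
L^2((0, oo), dx/x), and its value at x only involves the function on (0, x),
hence it is a contraction on (0, 1). For the form, the loss is the explicit
square 2 t (sum_i c_i / (s_i + t))^2. *)
Lemma cauchy_form_blaschke {R : realType} {I : finType} (c s : I -> R) (t : R) :
  (forall i, 0 < s i) -> 0 < t ->
  cauchy_form (fun i => c i * ((s i - t) / (s i + t))) s <=
  cauchy_form c s.
Proof.
move=> s0 t0; rewrite -subr_ge0.
have -> : cauchy_form c s -
    cauchy_form (fun i => c i * ((s i - t) / (s i + t))) s =
    2 * t * (\sum_i c i / (s i + t)) ^+ 2.
  rewrite expr2 mulr_suml mulr_sumr /cauchy_form -sumrB; apply: eq_bigr => i _.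
  rewrite mulr_sumr mulr_sumr -sumrB; apply: eq_bigr => j _.
  by field; rewrite !gt_eqF// addr_gt0.
by rewrite mulr_ge0 ?sqr_ge0// mulr_ge0// ltW.
Qed.

(** Iterating the contraction over all the exponents other than s i0 leaves the
single term of index i0, whose square norm is explicit. Repeated exponents are
covered since one factor of the product cancels all the terms that share it:
the terms of a Muntz polynomial may have equal exponents. *)
Lemma cauchy_form_ge {R : realType} {I : finType} (c s : I -> R) (i0 : I)
    (ts : seq R) :
  (forall i, 0 < s i) -> (forall t, t \in ts -> 0 < t) ->
  (forall i, i != i0 -> s i \in ts) ->
  c i0 ^+ 2 * \prod_(t <- ts) ((s i0 - t) / (s i0 + t)) ^+ 2 <=
  2 * s i0 * cauchy_form c s.
Proof.
move=> s0 ts0 sts.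
have iter (us : seq R) : (forall t, t \in us -> 0 < t) -> cauchy_form (fun i =>
    c i * \prod_(t <- us) ((s i - t) / (s i + t))) s <= cauchy_form c s.
  elim: us => [_|u us IH us0].
    by under eq_fun do rewrite big_nil mulr1.
  apply: le_trans (IH _); last by move=> t tus; apply: us0; rewrite inE tus orbT.
  have u0 : 0 < u by apply: us0; rewrite mem_head.
  apply: le_trans (cauchy_form_blaschke _ s u s0 u0).
  rewrite le_eqVlt; apply/orP; left; apply/eqP; congr cauchy_form.
  by apply/funext => i; rewrite big_cons mulrA mulrAC.
have := iter _ ts0; rewrite -(ler_pM2l (x := 2 * s i0)) ?mulr_gt0//.
move=> h; apply: (le_trans _ h); rewrite /cauchy_form.
have vanish i : i != i0 -> \prod_(t <- ts) ((s i - t) / (s i + t)) = 0.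
  by move=> /sts; move=> /(big_rem _) ->/=; rewrite subrr !mul0r.
rewrite (bigD1 i0)//= [X in _ + X]big1 => [|i ii0]; last first.
  by apply: big1 => j _; rewrite vanish// mulr0 !mul0r.
rewrite (bigD1 i0)//= [X in _ + X + _]big1 => [|j ji0]; last first.
  by rewrite [X in _ * (_ * X)]vanish// !mulr0 mul0r.
rewrite !addr0 prodrXl le_eqVlt; apply/orP; left; apply/eqP.
by field; rewrite -mulr2n mulrn_eq0 /= gt_eqF.
Qed.

(** * Sums of powers on an interval *)

Lemma powR_continuous_within {R : realType} (r b : R) : 0 < r -> 0 < b ->
  {within `[0, b], continuous (fun x : R => x `^ r)}.
Proof.
move=> r0 b0; have pc (x : R) : 0 < x -> {for x, continuous (fun x : R => x `^ r)}.
  move=> x0; apply/differentiable_continuous/derivable1_diffP.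
  by apply: derivable_powR; rewrite in_itv/= x0.
apply/continuous_within_itvP => //; split.
- by move=> x; rewrite in_itv/= => /andP[x0 _]; exact: pc.
- by rewrite powR0 ?gt_eqF//; exact: powR_cvg0.
- by apply: cvg_at_left_filter; exact: pc.
Qed.

Lemma continuous_within_sum {R : realType} (A : set R) n (h : 'I_n -> R -> R) :
  (forall i, {within A, continuous (h i)}) ->
  {within A, continuous (fun x => \sum_(i < n) h i x)}.
Proof.
elim: n h => [|n IH] h ch.
  by under [X in continuous X]eq_fun do rewrite big_ord0; exact: cst_continuous.
under [X in continuous X]eq_fun do rewrite big_ord_recr/=.
move=> x; apply: (@cvgD _ _ (subspace A)); last exact: ch.
by apply: (IH (fun i => h (widen_ord (leqnSn n) i))) => i; exact: ch.
Qed.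

Lemma is_derive1_sum {R : realType} n (h : 'I_n -> R -> R) (dh : 'I_n -> R)
    (x : R) : (forall i, is_derive x 1 (h i) (dh i)) ->
  is_derive x 1 (fun y => \sum_(i < n) h i y) (\sum_(i < n) dh i).
Proof.
move=> hdh; have -> : (fun y => \sum_(i < n) h i y) = \sum_(i < n) h i.
  by apply/funext => y; rewrite fct_sumE.
exact: is_derive_sum.
Qed.

(** The coefficient is divided by s so that a is what the derivative exhibits:
sums of such terms are primitives in ready-made form. *)
Lemma is_derive1_monomial {R : realType} (a s x : R) : 0 < x -> s != 0 ->
  is_derive x 1 (fun y => a / s * y `^ s) (a * x `^ (s - 1)).
Proof.
move=> x0 sn0; have /= := is_derive1_powR s x0 => d.
have := is_deriveZ (a / s) d; congr is_derive.
by rewrite /GRing.scale/=; field.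
Qed.

Lemma monomial_continuous_within {R : realType} (a s b : R) : 0 < s -> 0 < b ->
  {within `[0, b], continuous (fun x : R => a * x `^ s)}.
Proof.
move=> s0 b0 x; apply: (@cvgM _ (subspace `[0, b])); first exact: cvg_cst.
exact: powR_continuous_within.
Qed.

(** An L^2 norm is at most the sup norm eta. No integral is involved: the
difference A of the primitives of eta^2 and of the square of the sum is
nondecreasing, because its derivative is eta^2 minus that square. *)
Lemma cauchy_form_le_sup {R : realType} n (c s : 'I_n -> R) (eta : R) :
  (forall i, 0 < s i) ->
  (forall x : R, 0 < x < 1 -> `|\sum_(i < n) c i * x `^ (s i - 2^-1)| <= eta) ->
  cauchy_form c s <= eta ^+ 2.
Proof.
move=> s0 Heta.
have ss0 i j : 0 < s i + s j by rewrite addr_gt0.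
(* Both terms of A, including the linear one, have the shape a / s * x `^ s
   that is_derive1_monomial expects. *)
pose A (x : R) := eta ^+ 2 / 1 * x `^ 1 -
  \sum_(i < n) \sum_(j < n) c i * c j / (s i + s j) * x `^ (s i + s j).
have cA : {within `[0, 1], continuous A}.
  move=> x; apply: (@cvgB _ _ (subspace `[0, 1])).
    exact: monomial_continuous_within.
  apply: continuous_within_sum => i; apply: continuous_within_sum => j.
  exact: monomial_continuous_within.
have dA (x : R) : 0 < x -> is_derive x 1 A (eta ^+ 2 * x `^ (1 - 1) -
    \sum_(i < n) \sum_(j < n) c i * c j * x `^ (s i + s j - 1)).
  move=> x0; apply: is_deriveB; first exact: is_derive1_monomial.
  apply: is_derive1_sum => i; apply: is_derive1_sum => j.
  by apply: is_derive1_monomial => //; rewrite gt_eqF.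
have : A 0 <= A 1.
  apply: (@ger0_derive1_le_cc _ A 0 1) => //.
  - by move=> x; rewrite in_itv/= => /andP[x0 _]; have [] := dA x x0.
  - move=> x; rewrite in_itv/= => /andP[x0 x1].
    rewrite derive1E; have [_ ->] := dA x x0.
    rewrite subrr powRr0 mulr1 subr_ge0.
    have -> : \sum_(i < n) \sum_(j < n) c i * c j * x `^ (s i + s j - 1) =
        (\sum_(i < n) c i * x `^ (s i - 2^-1)) ^+ 2.
      rewrite expr2 mulr_suml; apply: eq_bigr => i _.
      rewrite mulr_sumr; apply: eq_bigr => j _.
      rewrite mulrACA -powRD; last by rewrite (gt_eqF x0) implybT.
      by congr (_ * _ `^ _); field.
    have hx : `|\sum_(i < n) c i * x `^ (s i - 2^-1)| <= eta.
      by apply: Heta; rewrite x0.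
    by rewrite -real_normK ?num_real// ler_sqr// nnegrE (le_trans _ hx).
  - by rewrite in_itv/= lexx ler01.
  - by rewrite in_itv/= lexx ler01.
rewrite /A powR0 ?oner_eq0// mulr0 powR1 divr1 mulr1.
rewrite [X in 0 - X]big1 => [|i _]; last first.
  by apply: big1 => j _; rewrite powR0 ?mulr0// gt_eqF.
rewrite subrr subr_ge0; congr (_ <= _).
by apply: eq_bigr => i _; apply: eq_bigr => j _; rewrite mulr1.
Qed.

Lemma primitive_le_integral {R : realType} n (c s : 'I_n -> R) (x : R) :
  (forall i, 0 < s i) -> 0 < x ->
  ((`|\sum_(i < n) c i / (s i + 1) * x `^ (s i + 1)|)%:E <=
   \int[@lebesgue_measure R]_(t in `[0%R, x])
     (`|\sum_(i < n) c i * t `^ s i|)%:E)%E.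
Proof.
move=> s0 x0.
have s10 i : 0 < s i + 1 by rewrite addr_gt0.
pose h (t : R) : R := \sum_(i < n) c i * t `^ s i.
pose H (t : R) : R := \sum_(i < n) c i / (s i + 1) * t `^ (s i + 1).
have ch : {within `[0, x], continuous h}.
  by apply: continuous_within_sum => i; exact: monomial_continuous_within.
have cH : {within `[0, x], continuous H}.
  by apply: continuous_within_sum => i; exact: monomial_continuous_within.
have dH (t : R) : 0 < t -> is_derive t 1 H (h t).
  move=> t0; apply: is_derive1_sum => i.
  have -> : c i * t `^ s i = c i * t `^ (s i + 1 - 1) by rewrite addrK.
  by apply: is_derive1_monomial => //; rewrite gt_eqF.
have FTC : (\int[@lebesgue_measure R]_(t in `[0%R, x]) (h t)%:E =
    (H x)%:E - (H 0)%:E)%E.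
  apply: continuous_FTC2 => //.
  - have /(continuous_within_itvP _ x0)[_ H0 Hx] := cH.
    split => // t; rewrite in_itv/= => /andP[t0 _].
    by have [] := dH t t0.
  - move=> t; rewrite in_itv/= => /andP[t0 _].
    by rewrite derive1E; have [] := dH t t0.
have H00 : H 0 = 0.
  by rewrite /H big1// => i _; rewrite powR0 ?mulr0// gt_eqF.
have -> : (`|H x|)%:E =
    (`| \int[@lebesgue_measure R]_(t in `[0%R, x]) (h t)%:E |)%E.
  by rewrite FTC H00 sube0.
apply: le_trans (le_abse_integral _ _ _) _ => //.
by apply/measurable_EFinP; exact: subspace_continuous_measurable_fun.
Qed.

(** * The coefficient functional on Muntz polynomials *)

(** With the shifts by 3/2 under which it is used, the factor of index k is the
square of (s - t) / (s + t) for s = mu + 3/2 and t = lambda k + 3/2. Its inverse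
is exp(O(1 / lambda k)): the distance from lambda k to mu is at least a fixed
fraction of lambda k, since their ratio tends to 1 and never vanishes. *)
Lemma muntz_product_bound {R : realType} (lambda : nat -> R) (mu : R) :
  (forall k, 0 < lambda k) -> cvgn (series (fun k => (lambda k)^-1)) ->
  0 < mu -> ~ range lambda mu ->
  exists2 K : R, 0 < K & forall N, 1 <= K * \prod_(k <- iota 0 N)
    ((mu - lambda k) / (mu + lambda k + 3)) ^+ 2.
Proof.
move=> l0 lsum mu0 muN.
have lmu k : lambda k - mu != 0.
  by rewrite subr_eq0; apply/eqP => lk; apply: muN; exists k.
have [M M0 HM] : exists2 M : R, 0 < M & forall k, `|lambda k - mu|^-1 <= M / lambda k.
  have cv : (1 - mu * (lambda k)^-1)^-1 @[k --> \oo] --> (1 - mu * 0)^-1.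
    apply: cvgV; first by rewrite mulr0 subr0 oner_eq0.
    apply: cvgB; first exact: cvg_cst.
    by apply: cvgM; [exact: cvg_cst|exact: cvg_series_cvg_0].
  have [M [_ HM]] := cvg_seq_bounded (cvgP _ cv).
  exists (`|M| + 1); first by rewrite ltr_wpDl.
  move=> k; have := HM (`|M| + 1) _ k I.
  rewrite (le_lt_trans (ler_norm M)) ?ltrDl// => /(_ isT)/=.
  have -> : (1 - mu / lambda k)^-1 = lambda k * (lambda k - mu)^-1.
    by field; rewrite lmu gt_eqF.
  by rewrite normrM normfV gtr0_norm// ler_pdivlMr// mulrC.
pose D : R := (2 * mu + 3) * M.
pose S : R := limn (series (fun k => (lambda k)^-1)).
exists (expR (2 * D * S)); first exact: expR_gt0.
move=> N.
have step k : expR (- (2 * D * (lambda k)^-1)) <=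
    ((mu - lambda k) / (mu + lambda k + 3)) ^+ 2.
  have p0 : 0 < mu + lambda k + 3 by rewrite !addr_gt0.
  have a0 : 0 < `|lambda k - mu| by rewrite normr_gt0.
  have inv : (mu + lambda k + 3) / `|lambda k - mu| <= expR (D * (lambda k)^-1).
    apply: le_trans (expR_ge1Dx _).
    have : mu + lambda k + 3 <= `|lambda k - mu| + (2 * mu + 3).
      have := ler_norm (lambda k - mu); lra.
    rewrite -(ler_pM2r (x := `|lambda k - mu|^-1)) ?invr_gt0//.
    move=> /le_trans; apply; rewrite mulrDl divff ?gt_eqF// lerD2l /D -mulrA.
    by rewrite ler_wpM2l ?HM// addr_ge0// mulr_ge0// ltW.
  rewrite -mulrA mulr_natl mulr2n opprD expRD -expr2.
  rewrite -[X in _ <= X]real_normK ?num_real// ler_sqr ?nnegrE ?expR_ge0//.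
  rewrite normrM normfV (gtr0_norm p0) distrC expRN.
  rewrite -[X in _ <= X]invrK lef_pV2 ?posrE ?expR_gt0//; last first.
    by rewrite invr_gt0 divr_gt0.
  by rewrite invf_div.
have prod_ge : expR (- (2 * D * series (fun k => (lambda k)^-1) N)) <=
    \prod_(k <- iota 0 N) ((mu - lambda k) / (mu + lambda k + 3)) ^+ 2.
  rewrite /series/= /index_iota subn0 mulr_sumr -sumrN expR_sum.
  by apply: ler_prod => k _; rewrite expR_ge0 step.
apply: le_trans (_ : expR (2 * D * S) *
    expR (- (2 * D * series (fun k => (lambda k)^-1) N)) <= _); last first.
  by rewrite ler_wpM2l// expR_ge0.
rewrite -expRD -mulrBr; apply: le_trans (expR_ge1Dx _).
have D0 : 0 <= 2 * D by rewrite ltW// !mulr_gt0// addr_gt0// mulr_gt0.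
rewrite lerDl; apply: mulr_ge0 => //.
rewrite subr_ge0; apply: nondecreasing_cvgn_le => //.
by apply/nondecreasing_seqP => k; rewrite !seriesEnat/= big_nat_recr//= lerDl invr_ge0 ltW.
Qed.

(** The hypothesis bounds a primitive of b x^mu + sum_i c_i x^(l_i), on [0, r]
only; the rescaling x -> r x turns it into a bound on [0, 1], where the Cauchy
form applies to the exponents mu + 1 and l_i + 1. *)
Lemma muntz_coef_bound {R : realType} (lambda : nat -> R) (mu : R) :
  (forall k, 0 < lambda k) -> cvgn (series (fun k => (lambda k)^-1)) ->
  0 < mu -> ~ range lambda mu ->
  exists2 K : R, 0 < K & forall n (c l : 'I_n -> R) (b eta r : R),
    (forall i, range lambda (l i)) -> 0 < r ->
    (forall x, 0 < x <= r ->
      `|b / (mu + 1) * x `^ (mu + 1) +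
        \sum_(i < n) c i / (l i + 1) * x `^ (l i + 1)| <= eta) ->
    `|b| * r `^ (mu + 1) <= K * eta.
Proof.
move=> l0 lsum mu0 muN.
have [K K0 HK] := muntz_product_bound _ _ l0 lsum mu0 muN.
pose s0 : R := mu + 3 / 2.
have s00 : 0 < s0 by rewrite addr_gt0.
exists ((mu + 1) * Num.sqrt (2 * s0 * K)).
  by rewrite mulr_gt0 ?addr_gt0// sqrtr_gt0 !mulr_gt0.
move=> n c l b eta r ll r0 Heta.
(* Coefficients of the primitive rescaled to [0, 1]; index 0 stands for mu. The
   form takes exponents raised by 1/2, hence mu + 3/2 and l_i + 3/2. *)
pose C (i : 'I_n.+1) := if unlift ord0 i is Some j
  then c j / (l j + 1) * r `^ (l j + 1) else b / (mu + 1) * r `^ (mu + 1).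
pose s (i : 'I_n.+1) := if unlift ord0 i is Some j then l j + 3 / 2 else s0.
have lpos i : 0 < l i by have [k _ <-] := ll i.
have spos i : 0 < s i.
  by rewrite /s; case: unlift => [j|]; rewrite // addr_gt0.
have [N HN] : exists N, forall i, exists2 k, (k < N)%N & l i = lambda k.
  have /choice[f Hf] : forall i, exists k, l i = lambda k.
    by move=> i; have [k _ <-] := ll i; exists k.
  exists (\max_(i < n) f i).+1 => i; exists (f i) => //.
  by rewrite ltnS; exact: leq_bigmax.
have form_le : cauchy_form C s <= eta ^+ 2.
  apply: cauchy_form_le_sup => // x /andP[x0 x1].
  rewrite big_ord_recl {1}/C {1}/s unlift_none.
  under eq_bigr do rewrite /C /s liftK.
  have e32 (t : R) : t + 3 / 2 - 2^-1 = t + 1 by field.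
  rewrite /s0 e32; under eq_bigr do rewrite e32.
  have := Heta (r * x); rewrite mulr_gt0//= ler_piMr ?(ltW x1) ?(ltW r0)// => /(_ isT).
  under eq_bigr do rewrite (powRM _ (ltW r0) (ltW x0)) mulrA.
  by rewrite (powRM _ (ltW r0) (ltW x0)) mulrA.
pose ts := [seq lambda k + 3 / 2 | k <- iota 0 N].
have ts_gt0 t : t \in ts -> 0 < t by move=> /mapP[k _ ->]; rewrite addr_gt0.
have s_ts i : i != ord0 -> s i \in ts.
  case: (unliftP ord0 i) => [j ->|->]; last by rewrite eqxx.
  move=> _; rewrite /s liftK; have [k kN ->] := HN j.
  by apply: map_f; rewrite mem_iota.
have := cauchy_form_ge C s ord0 ts spos ts_gt0 s_ts.
rewrite {1}/C {1 2 3}/s unlift_none big_map => form_ge.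
have prodE : \prod_(k <- iota 0 N)
    ((s0 - (lambda k + 3 / 2)) / (s0 + (lambda k + 3 / 2))) ^+ 2 =
    \prod_(k <- iota 0 N) ((mu - lambda k) / (mu + lambda k + 3)) ^+ 2.
  by apply: eq_bigr => k _; congr ((_ / _) ^+ 2); rewrite /s0; field.
rewrite prodE in form_ge.
set c0 := b / (mu + 1) * r `^ (mu + 1) in form_ge.
have c0_le : c0 ^+ 2 <= 2 * s0 * K * eta ^+ 2.
  apply: le_trans (_ : c0 ^+ 2 * (K * \prod_(k <- iota 0 N) ((mu - lambda k) / (mu + lambda k + 3)) ^+ 2) <= _).
    by rewrite ler_peMr ?sqr_ge0 ?HK.
  rewrite mulrCA (mulrC _ K) -[X in _ <= X]mulrA ler_wpM2l ?(ltW K0)//.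
  apply: le_trans form_ge _.
  by rewrite ler_wpM2l// mulr_ge0// ltW.
have eta0 : 0 <= eta by apply: le_trans (Heta r _); rewrite ?r0 ?lexx.
have : `|c0| <= Num.sqrt (2 * s0 * K) * eta.
  rewrite -sqrtr_sqr -[X in _ * X]ger0_norm// -[X in _ * X]sqrtr_sqr -sqrtrM.
    by rewrite ler_sqrt// mulr_ge0 ?sqr_ge0// !mulr_ge0 ?ltW.
  by rewrite !mulr_ge0 ?ltW.
have mu1 : 0 < mu + 1 by rewrite addr_gt0.
rewrite -(ler_pM2l mu1) mulrA; apply: le_trans.
rewrite /c0 !normrM normfV (gtr0_norm mu1) (gtr0_norm (powR_gt0 _ r0)).
by rewrite mulrA mulrCA divff ?mulr1// gt_eqF.
Qed.

(** * The binomial series at zero *)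

(** The generalized binomial coefficient a (a - 1) ... (a - j + 1) / j!. The
recursion on a - 1 is the one produced by differentiating (1 + t)^a. *)
Fixpoint gbinom {R : realType} (a : R) (j : nat) : R :=
  if j is k.+1 then a / k.+1%:R * gbinom (a - 1) k else 1.

Lemma gbinom_gt0 {R : realType} (a : R) j : j%:R < a + 1 -> 0 < gbinom a j.
Proof.
elim: j a => [a _|j IH a]; first exact: ltr01.
rewrite -natr1 ltrD2r => ja /=; rewrite mulr_gt0//; last by rewrite IH// subrK.
by rewrite divr_gt0// (le_lt_trans _ ja).
Qed.

Lemma powR_bounded_near1 {R : realType} (a : R) :
  exists2 C : R, 0 <= C & forall t : R, `|t| <= 2^-1 -> `|(1 + t) `^ a| <= C.
Proof.
exists (2 `^ a + 2^-1 `^ a); first by rewrite addr_ge0 ?powR_ge0.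
move=> t; rewrite ler_norml => /andP[tl tr].
rewrite ger0_norm ?powR_ge0//.
have [a0|a0] := leP 0 a.
  rewrite ler_wpDr ?powR_ge0// ge0_ler_powR ?nnegrE//; lra.
rewrite ler_wpDl ?powR_ge0// -[a]opprK !(powRN _ (- a)).
rewrite lef_pV2 ?posrE ?powR_gt0//; [|lra].
rewrite ge0_ler_powR ?nnegrE//; lra.
Qed.

(** By induction on m: the remainder of order m.+1 for a vanishes at 0 and its
derivative is a times the remainder of order m for a - 1, so that the mean value
theorem gains one factor t. *)
Lemma binomial_taylor {R : realType} (m : nat) (a : R) :
  exists2 C : R, 0 <= C & forall t : R, `|t| <= 2^-1 ->
    `|(1 + t) `^ a - \sum_(i < m) gbinom a i * t ^+ i| <= C * `|t| ^+ m.
Proof.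
elim: m a => [|m IH] a.
  have [C C0 HC] := powR_bounded_near1 a; exists C => // t t2.
  by rewrite big_ord0 subr0 expr0 mulr1 HC.
have [C C0 HC] := IH (a - 1).
exists (`|a| * C); first by rewrite mulr_ge0.
move=> t t2.
pose f (x : R) : R := (1 + x) `^ a - \sum_(i < m.+1) gbinom a i * x ^+ i.
pose df (x : R) : R := a * ((1 + x) `^ (a - 1) - \sum_(i < m) gbinom (a - 1) i * x ^+ i).
have fdf (x : R) : `|x| <= 2^-1 -> is_derive x 1 f (df x).
  move=> x2; have x1 : 0 < 1 + x.
    by move: x2; rewrite ler_norml => /andP[? ?]; lra.
  rewrite /df mulrBr; apply: is_deriveB.
    have d1 : is_derive x 1 (fun y : R => 1 + y) 1.
      by have := is_deriveD (is_derive_cst (1 : R) x 1) (is_derive_id x 1); rewrite add0r.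
    have := is_derive1_comp (is_derive1_powR a x1) d1.
    by rewrite /GRing.scale/= mulr1.
  have -> : a * (\sum_(i < m) gbinom (a - 1) i * x ^+ i) =
     \sum_(i < m.+1) gbinom a i * (i%:R * x ^+ i.-1).
    rewrite big_ord_recl/= mul0r mulr0 add0r mulr_sumr.
    apply: eq_bigr => i _ /=; rewrite -natr1; field.
    by rewrite natr1 pnatr_eq0.
  apply: is_derive1_sum => i.
  have -> : (fun y : R => gbinom a i * y ^+ i) = gbinom a i *: (id : R -> R) ^+ i.
    by apply/funext => y; rewrite scalrfctE exprfctE.
  have := is_deriveZ (gbinom a i) (is_deriveX i (is_derive_id x (1 : R))).
  by congr is_derive; rewrite /GRing.scale/= mulr1.
have f0 : f 0 = 0.
  rewrite /f addr0 powR1 big_ord_recl/= expr0 mulr1.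
  by rewrite big1 ?addr0 ?subrr// => i _; rewrite expr0n/= mulr0.
have fc (x y : R) : `|x| <= 2^-1 -> `|y| <= 2^-1 -> x <= y ->
    exists2 c, x <= c <= y & f y - f x = df c * (y - x).
  move=> x2 y2 xy; have xy2 z : z \in `[x, y] -> `|z| <= 2^-1.
    move=> /[!in_itv]/= /andP[xz zy]; move: x2 y2; rewrite !ler_norml.
    by move=> /andP[? ?] /andP[? ?]; apply/andP; split; lra.
  have [] := @MVT_segment _ f df x y xy.
  - by move=> z /subset_itv_oo_cc zxy; apply/fdf/xy2.
  - apply: derivable_within_continuous => z zxy.
    by have [] := fdf z (xy2 _ zxy).
  by move=> c cxy ->; exists c => //; move: cxy; rewrite in_itv.
have [c ct fE] : exists2 c, `|c| <= `|t| & f t = df c * t.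
  have z2 : `|0 : R| <= 2^-1 by rewrite normr0 invr_ge0.
  have [t0|t0] := leP 0 t.
    have [c /andP[c0 ct]] := fc _ _ z2 t2 t0; rewrite f0 !subr0 => ->.
    by exists c => //; rewrite !ger0_norm.
  have [c /andP[ct c0]] := fc _ _ t2 z2 (ltW t0); rewrite f0 !sub0r mulrN.
  by move=> /oppr_inj ->; exists c => //; rewrite (ltr0_norm t0) ler0_norm ?lerN2.
rewrite -/(f t) fE /df !normrM exprSr mulrA ler_wpM2r// -mulrA ler_wpM2l//.
apply: le_trans (HC c _) _; first exact: le_trans t2.
by rewrite ler_wpM2l// lerXn2r ?nnegrE.
Qed.

(** * The map alpha x^zeta1 + beta x^zeta2 near zero *)

Lemma powR_small {R : realType} (d y : R) : 0 < d -> 0 < y ->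
  exists2 r : R, 0 < r & forall x, 0 < x <= r -> x `^ d <= y.
Proof.
move=> d0 y0; exists (y `^ d^-1); first exact: powR_gt0.
move=> x /andP[x0 xr]; have := ge0_ler_powR (ltW d0) _ _ xr.
rewrite !nnegrE ltW// powR_ge0 -powRrM mulVf ?gt_eqF// powRr1 ?(ltW y0)//.
exact.
Qed.

Lemma binomial_map_factor {R : realType} (alpha beta zeta1 zeta2 x : R) :
  alpha != 0 -> 0 < x -> alpha * x `^ zeta1 + beta * x `^ zeta2 =
  alpha * x `^ zeta1 * (1 + beta / alpha * x `^ (zeta2 - zeta1)).
Proof.
move=> a0 x0; have -> : x `^ zeta2 = x `^ zeta1 * x `^ (zeta2 - zeta1).
  by rewrite -powRD ?(gt_eqF x0) ?implybT// subrKC.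
by field.
Qed.

(** Close to 0 the term alpha x^zeta1 dominates and gives its sign to the map. *)
Lemma binomial_map_lead_gt0 {R : realType} (alpha beta zeta1 zeta2 : R) :
  alpha != 0 -> beta != 0 -> zeta1 < zeta2 ->
  (forall x : R, 0 < x <= 1 -> 0 <= alpha * x `^ zeta1 + beta * x `^ zeta2) ->
  0 < alpha.
Proof.
move=> a0 b0 z12 phi0.
have d0 : 0 < zeta2 - zeta1 by rewrite subr_gt0.
have ba0 : 0 < `|beta / alpha| by rewrite normr_gt0 mulf_neq0 ?invr_eq0.
have [r r0 Hr] := powR_small (zeta2 - zeta1) ((2 * `|beta / alpha|)^-1) d0
  ltac:(by rewrite invr_gt0 mulr_gt0).
pose x := Num.min r 1.
have x0 : 0 < x by rewrite lt_min r0 ltr01.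
have x1 : 0 < x <= 1 by rewrite x0 ge_min lexx orbT.
have := phi0 _ x1; rewrite binomial_map_factor//.
have u2 : `|beta / alpha * x `^ (zeta2 - zeta1)| <= 2^-1.
  rewrite normrM (gtr0_norm (powR_gt0 _ x0)) -ler_pdivlMl// -invfM.
  by rewrite (mulrC _ 2) Hr// x0 ge_min lexx.
have u1 : 0 < 1 + beta / alpha * x `^ (zeta2 - zeta1).
  by move: u2; rewrite ler_norml => /andP[? ?]; lra.
by rewrite pmulr_lge0// pmulr_lge0 ?powR_gt0// le_eqVlt eq_sym (negPf a0).
Qed.

Lemma binomial_map_power_expansion {R : realType}
    (alpha beta zeta1 zeta2 a : R) (m : nat) :
  0 < alpha -> beta != 0 -> zeta1 < zeta2 ->
  exists2 r0 : R, 0 < r0 & exists C : R, forall x, 0 < x <= r0 ->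
    `|(alpha * x `^ zeta1 + beta * x `^ zeta2) `^ a -
      \sum_(i < m) alpha `^ a * gbinom a i * (beta / alpha) ^+ i *
        x `^ (zeta1 * a + i%:R * (zeta2 - zeta1))| <=
    C * x `^ (zeta1 * a + m%:R * (zeta2 - zeta1)).
Proof.
move=> a0 b0 z12.
have d0 : 0 < zeta2 - zeta1 by rewrite subr_gt0.
have ba0 : 0 < `|beta / alpha|.
  by rewrite normr_gt0 mulf_neq0 ?invr_eq0// gt_eqF.
have [r r0 Hr] := powR_small (zeta2 - zeta1) ((2 * `|beta / alpha|)^-1) d0
  ltac:(by rewrite invr_gt0 mulr_gt0).
have [C C0 HC] := binomial_taylor m a.
exists r => //; exists (alpha `^ a * C * `|beta / alpha| ^+ m).
move=> x /andP[x0 xr].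
have u2 : `|beta / alpha * x `^ (zeta2 - zeta1)| <= 2^-1.
  rewrite normrM (gtr0_norm (powR_gt0 _ x0)) -ler_pdivlMl// -invfM.
  by rewrite (mulrC _ 2) Hr// x0.
have u1 : 0 <= 1 + beta / alpha * x `^ (zeta2 - zeta1).
  by move: u2; rewrite ler_norml => /andP[? ?]; lra.
have powE i : x `^ (zeta1 * a + i%:R * (zeta2 - zeta1)) =
    x `^ (zeta1 * a) * (x `^ (zeta2 - zeta1)) ^+ i.
  rewrite (@powRD _ x (zeta1 * a)) ?(gt_eqF x0) ?implybT//; congr (_ * _).
  by rewrite mulrC powRrM powR_mulrn// powR_ge0.
rewrite binomial_map_factor ?gt_eqF// !powRM ?mulr_ge0 ?powR_ge0 ?(ltW a0)//.
rewrite -powRrM.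
have -> : \sum_(i < m) alpha `^ a * gbinom a i * (beta / alpha) ^+ i *
      x `^ (zeta1 * a + i%:R * (zeta2 - zeta1)) =
    alpha `^ a * x `^ (zeta1 * a) *
    \sum_(i < m) gbinom a i * (beta / alpha * x `^ (zeta2 - zeta1)) ^+ i.
  rewrite mulr_sumr; apply: eq_bigr => i _; rewrite powE [in RHS]exprMn.
  ring.
have c0 : 0 < alpha `^ a * x `^ (zeta1 * a) by rewrite mulr_gt0 ?powR_gt0.
rewrite -mulrBr normrM (gtr0_norm c0) powE.
have -> : alpha `^ a * C * `|beta / alpha| ^+ m *
    (x `^ (zeta1 * a) * x `^ (zeta2 - zeta1) ^+ m) =
    alpha `^ a * x `^ (zeta1 * a) *
      (C * `|beta / alpha * x `^ (zeta2 - zeta1)| ^+ m).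
  rewrite [X in _ * (C * X ^+ m)]normrM (gtr0_norm (powR_gt0 _ x0)) exprMn.
  ring.
by rewrite ler_pM2l// HC.
Qed.

(** * Comparison of norms and the leading exponents of a Muntz function *)

(** Hoelder's inequality against the indicator of [0, 1], which has norm 1. *)
Lemma L1_le_Lp01_norm {R : realType} (p : R) (f : R -> R) : 1 <= p ->
  measurable_fun setT (f \_ `[0, 1]) ->
  (\int[@lebesgue_measure R]_(x in `[0%R, 1%R]) (`|f x|)%:E <= Lp01_norm p f)%E.
Proof.
move=> p1 mf.
have E1 : (\int[@lebesgue_measure R]_(x in `[0%R, 1%R]) (`|f x|)%:E =
    Lnorm (@lebesgue_measure R) 1 (EFin \o (f \_ `[0%R, 1%R])%R))%E.
  rewrite Lnorm1 [LHS]integral_mkcond; apply: eq_integral => x _ /=.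
  by rewrite !patchE; case: ifP => //; rewrite normr0.
rewrite E1 /Lp01_norm; move: p1; rewrite le_eqVlt => /predU1P[<-//|p1].
have p0 : 0 < p by apply: lt_trans p1.
pose q := (1 - p^-1)^-1.
have qV0 : 0 < 1 - p^-1 by rewrite subr_gt0 invf_lt1.
have q0 : 0 < q by rewrite invr_gt0.
have pq : p^-1 + q^-1 = 1 by rewrite invrK subrKC.
have mi : measurable_fun setT (\1_(`[0, 1]%classic : set R) : R -> R).
  exact: measurable_indic.
have := @hoelder _ _ _ (@lebesgue_measure R) _ _ p q mf mi p0 q0 pq.
have -> : ((f \_ `[0, 1]) \* \1_(`[0, 1]%classic : set R))%R = f \_ `[0, 1].
  apply/funext => x; rewrite /= indicE patchE.
  by case: ifP => /= _; rewrite ?mulr1 ?mul0r.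
have -> : Lnorm (@lebesgue_measure R) q%:E
    (EFin \o (\1_(`[0, 1]%classic : set R) : R -> R)) = 1%E.
  rewrite unlock /Lnorm.
  under eq_integral => x _.
    rewrite /=; have -> : (`|\1_(`[0, 1]%classic : set R) x| `^ q : R) = \1_(`[0, 1]%classic : set R) x.
      rewrite indicE; case: (_ \in _); rewrite ?normr1 ?powR1// normr0 powR0//.
      by rewrite gt_eqF.
    over.
  rewrite integral_indic//= setIT lebesgue_measure_itv/= lte_fin ltr01.
  by rewrite sube0 poweR1r.
by rewrite mule1.
Qed.

Lemma Lp01_measurable {R : realType} (p : R) (f : R -> R) : Lp01 p f ->
  measurable_fun (`[0, 1]%classic : set R) f.
Proof.
rewrite /Lp01/= inE => /andP[/[!inE]/= mf _].
by apply/measurable_restrictT.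
Qed.

Lemma monomial_spanB {R : realType} (Lambda : set R) (g : R -> R) J
    (b mu : 'I_J -> R) : monomial_span Lambda g -> (forall i, Lambda (mu i)) ->
  monomial_span Lambda (fun x => g x - \sum_(i < J) b i * x `^ mu i).
Proof.
move=> [n [c [l [Ll ->]]]] Lmu.
exists (n + J)%N,
  (fun i : 'I_(n + J) => match fintype.split i with inl i => c i | inr i => - b i end),
  (fun i : 'I_(n + J) => match fintype.split i with inl i => l i | inr i => mu i end); split.
  by move=> i; case: fintype.split.
apply/funext => x; rewrite big_split_ord/= -sumrN; congr (_ + _).
  by apply: eq_bigr => i _; rewrite (unsplitK (inl i)).
by apply: eq_bigr => i _; rewrite (unsplitK (inr i)) mulNr.
Qed.

Lemma monomial_span_measurable {R : realType} (Lambda : set R) (g : R -> R) :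
  (forall l, Lambda l -> 0 < l) -> monomial_span Lambda g ->
  measurable_fun (`[0, 1]%classic : set R) g.
Proof.
move=> L0 [n [c [l [Ll ->]]]]; apply: subspace_continuous_measurable_fun => //.
apply: continuous_within_sum => i; apply: monomial_continuous_within => //.
exact/L0/Ll.
Qed.

(** An asymptotic expansion at 0 of a function of the Muntz space can leave
Lambda only with a zero coefficient. The coefficient bound is applied to an
approximant minus the expansion, on [0, r] with r small; the gain r^(nu - mu_J)
of the remainder over the term of exponent mu_J decides. *)
Lemma muntz_leading_coef {R : realType} (p : R) (lambda : nat -> R)
    (F : R -> R) (J : nat) (b mu : nat -> R) (C nu r0 : R) :
  1 <= p -> (forall k, 0 < lambda k) ->
  cvgn (series (fun k => (lambda k)^-1)) ->
  muntz_space p (range lambda) F ->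
  (forall i, (i < J)%N -> range lambda (mu i)) ->
  ~ range lambda (mu J) -> 0 < mu J -> mu J < nu -> 0 < r0 ->
  (forall x, 0 < x <= r0 ->
    `|F x - \sum_(i < J.+1) b i * x `^ mu i| <= C * x `^ nu) ->
  b J = 0.
Proof.
move=> p1 l0 lsum [LF Fapp] muL muJ muJ0 munu r00 FC.
have Lpos l : range lambda l -> 0 < l by move=> [k _ <-].
have C0 : 0 <= C.
  have := le_trans (normr_ge0 _) (FC r0 ltac:(by rewrite r00 lexx)).
  by rewrite pmulr_lge0// powR_gt0.
have [K K0 HK] := muntz_coef_bound _ _ l0 lsum muJ0 muJ.
have mF := Lp01_measurable _ _ LF.
have main (e r : R) : 0 < e -> 0 < r -> r <= 1 -> r <= r0 ->
    `|b J| * r `^ (mu J + 1) <= K * (e + C * r `^ nu * r).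
  move=> e0 rpos r1 rr0; have [P SP Pe] := Fapp e e0.
  have mFP : measurable_fun (`[0, 1]%classic : set R) (F \- P)%R.
    by apply: measurable_funB => //; exact: monomial_span_measurable SP.
  have intFP : (\int[@lebesgue_measure R]_(x in `[0%R, 1%R])
      (`|(F \- P) x|)%:E <= e%:E)%E.
    apply: le_trans (ltW Pe); apply: L1_le_Lp01_norm => //.
    by apply: (measurable_restrictT _ _).1 mFP.
  have [n [c [l [Ll gE]]]] := monomial_spanB _ _ _ (fun i : 'I_J => b i)
    (fun i : 'I_J => mu i) SP (fun i => muL i (ltn_ord i)).
  rewrite -normrN; apply: (HK n c l) => // x /andP[x0 xr].
  (* The approximant minus the expansion up to index J, as one sum of powers. *)
  pose c' (i : 'I_n.+1) := if unlift ord0 i is Some j then c j else - b J.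
  pose l' (i : 'I_n.+1) := if unlift ord0 i is Some j then l j else mu J.
  have l'0 i : 0 < l' i.
    by rewrite /l'; case: unlift => [j|//]; exact/Lpos/Ll.
  have := primitive_le_integral _ c' l' x l'0 x0.
  rewrite big_ord_recl {1}/c' {1 2}/l' unlift_none.
  under eq_bigr do rewrite /c' /l' liftK.
  rewrite -lee_fin => /le_trans; apply.
  have hE t : \sum_(i < n.+1) c' i * t `^ l' i =
      P t - \sum_(i < J.+1) b i * t `^ mu i.
    rewrite big_ord_recl {1}/c' {1}/l' unlift_none.
    under eq_bigr do rewrite /c' /l' liftK.
    have := congr1 (@^~ t) gE => /= <-.
    by rewrite big_ord_recr/=; ring.
  under eq_integral do rewrite hE.
  have x1 : x <= 1 by apply: le_trans xr r1.
  have sub : `[0, x] `<=` (`[0, 1] : set R).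
    by apply: subset_itvl; rewrite bnd_simp.
  apply: (@le_trans _ _ (\int[@lebesgue_measure R]_(t in `[0%R, x])
      ((`|(F \- P)%R t|)%:E + (C * r `^ nu)%:E))%E).
    apply: ge0_le_integral => //.
    - apply/measurable_EFinP; apply: measurableT_comp => //.
      have -> : (fun t => P t - \sum_(i < J.+1) b i * t `^ mu i) =
          (fun t => \sum_(i < n.+1) c' i * t `^ l' i).
        by apply/funext => t; rewrite hE.
      apply: subspace_continuous_measurable_fun => //.
      by apply: continuous_within_sum => i; exact: monomial_continuous_within.
    - apply/emeasurable_funD => //; apply/measurable_EFinP.
      apply: measurableT_comp => //.
      by apply: measurable_funS mFP => //.
    - move=> t; rewrite /= in_itv/= => /andP[t0 tx].
      rewrite -EFinD lee_fin; move: t0; rewrite le_eqVlt => /predU1P[<-|t0].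
        rewrite -hE big1 ?normr0 => [|i _]; last by rewrite powR0 ?mulr0// gt_eqF.
        by rewrite addr_ge0// mulr_ge0// powR_ge0.
      have tr0 : 0 < t <= r0 by rewrite t0 (le_trans tx)// (le_trans xr).
      have -> : P t - \sum_(i < J.+1) b i * t `^ mu i =
        - (F t - P t) + (F t - \sum_(i < J.+1) b i * t `^ mu i) by ring.
      apply: le_trans (ler_normD _ _) _; rewrite normrN lerD2l.
      apply: le_trans (FC t tr0) _; rewrite ler_wpM2l//.
      apply: ge0_ler_powR; rewrite ?nnegrE ?(ltW t0) ?(ltW rpos) ?(le_trans tx)//.
      exact: ltW (lt_trans muJ0 munu).
  rewrite ge0_integralD//=; last 2 first.
  - apply/measurable_EFinP; apply: measurableT_comp => //.
    exact: measurable_funS mFP.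
  - by move=> t _; rewrite lee_fin mulr_ge0// powR_ge0.
  rewrite EFinD; apply: leeD.
    apply: le_trans intFP; apply: ge0_subset_integral => //.
    by apply/measurable_EFinP; apply: measurableT_comp.
  rewrite integral_cst//= lebesgue_measure_itv/= lte_fin x0 sube0 -EFinM lee_fin.
  by rewrite ler_wpM2l// mulr_ge0// powR_ge0.
(* The approximation error e tends to 0 with r fixed. *)
have lim r : 0 < r -> r <= 1 -> r <= r0 ->
    `|b J| <= K * C * r `^ (nu - mu J).
  move=> rpos r1 rr0.
  have rmu : 0 < r `^ (mu J + 1) by exact: powR_gt0.
  rewrite -(ler_pM2r rmu) -[X in _ <= X]mulrA -powRD ?(gt_eqF rpos) ?implybT//.
  have -> : nu - mu J + (mu J + 1) = nu + 1 by ring.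
  apply/ler_addgt0Pr => e e0.
  have eK : 0 < e / K by rewrite divr_gt0.
  apply: le_trans (main _ _ eK rpos r1 rr0) _.
  rewrite powRD ?(gt_eqF rpos) ?implybT// powRr1 ?(ltW rpos)//.
  by rewrite mulrDr mulrCA divff ?mulr1 ?gt_eqF// addrC !mulrA.
apply/eqP; apply: contraT => bJ0.
have nb : 0 < `|b J| by rewrite normr_gt0.
have KC0 : 0 < K * C + 1 by rewrite ltr_wpDl// mulr_ge0// ltW.
have d0 : 0 < nu - mu J by rewrite subr_gt0.
have [r rpos Hr] := powR_small _ _ d0 (divr_gt0 nb KC0).
pose r' := Num.min r (Num.min 1 r0).
have r'0 : 0 < r' by rewrite !lt_min rpos ltr01.
have r'1 : r' <= 1 by rewrite !ge_min lexx orbT.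
have r'r0 : r' <= r0 by rewrite !ge_min lexx !orbT.
have := lim r' r'0 r'1 r'r0; rewrite leNgt => /negP[].
have r'r : 0 < r' <= r by rewrite r'0 ge_min lexx.
apply: le_lt_trans (ler_wpM2l _ (Hr _ r'r)) _; first by rewrite mulr_ge0// ltW.
by rewrite mulrCA gtr_pMr// ltr_pdivrMr// mul1r ltrDl.
Qed.

(** * The counting argument and the conclusion *)

Lemma monomial_muntz {R : realType} (p : R) (Lambda : set R) (a : R) :
  1 <= p -> 0 < a -> Lambda a -> muntz_space p Lambda (fun x => x `^ a).
Proof.
move=> p1 a0 La; have p0 : 0 < p by apply: lt_le_trans p1.
have mf : measurable_fun setT ((fun x : R => x `^ a) \_ `[0, 1]).
  apply: (measurable_restrictT _ _).1 => //.
  apply: subspace_continuous_measurable_fun => //.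
  exact: powR_continuous_within.
split.
  rewrite /Lp01/= inE; apply/andP; split; rewrite inE//=.
  rewrite /finite_norm unlock /Lnorm; apply: poweR_lty.
  apply: (@le_lt_trans _ _ (\int[@lebesgue_measure R]_x
      (\1_(`[0, 1]%classic : set R) x)%:E)%E).
    apply: ge0_le_integral => //.
    - by move=> x _; rewrite lee_fin powR_ge0.
    - apply/measurable_EFinP.
      apply: (@measurableT_comp _ _ _ _ _ _ (@powR R ^~ p)) => //.
      exact: measurableT_comp.
    - by apply/measurable_EFinP; exact: measurable_indic.
    - move=> x _ /=; rewrite lee_fin patchE indicE.
      case: ifPn => [|_]; last by rewrite normr0 powR0 ?gt_eqF.
      rewrite inE/= in_itv/= => /andP[x0 x1].
      rewrite ger0_norm ?powR_ge0// -powRrM.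
      apply: le_trans (_ : 1 `^ (a * p) <= _); last by rewrite powR1.
      by rewrite ge0_ler_powR ?nnegrE// ltW// mulr_gt0.
  rewrite integral_indic//= setIT lebesgue_measure_itv/= lte_fin ltr01.
  by rewrite sube0 ltry.
move=> e e0; exists (fun x => x `^ a).
  exists 1%N, (fun=> 1), (fun=> a); split => //.
  by apply/funext => x; rewrite big_ord1 mul1r.
rewrite /Lp01_norm.
have -> : EFin \o (((fun x : R => x `^ a) \- (fun x => x `^ a))%R \_ `[0, 1]) =
    cst 0%E.
  by apply/funext => x /=; rewrite patchE; case: ifP => //= _; rewrite subrr.
by rewrite Lnorm0 ?lte_fin// eqe gt_eqF.
Qed.

(** For lambda k large, the more than lambda k terms zeta lambda k + j delta all
have reciprocal at least 1 / ((zeta + delta) lambda k), and they occur in lambda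
after an index N beyond which the partial sums grow by less than
1 / (zeta + delta). *)
Lemma progressions_not_summable {R : realType} (lambda : nat -> R)
    (zeta delta : R) :
  (forall k, 0 < lambda k) -> increasing_seq lambda ->
  cvgn (series (fun k => (lambda k)^-1)) -> 0 < zeta -> 0 < delta ->
  ~ (forall k j, j%:R <= lambda k ->
       range lambda (zeta * lambda k + j%:R * delta)).
Proof.
move=> l0 lincr lsum z0 d0 H.
pose S : nat -> R := series (fun k => (lambda k)^-1).
have Smono : nondecreasing_seq S.
  apply/nondecreasing_seqP => k.
  by rewrite /S !seriesEnat/= big_nat_recr//= lerDl invr_ge0 ltW.
have SS n : S n.+1 = S n + (lambda n)^-1.
  by rewrite /S !seriesEnat/= big_nat_recr.
have zd0 : 0 < zeta + delta by rewrite addr_gt0.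
have [N HN] : exists N, limn S - (zeta + delta)^-1 < S N.
  have : limn S - (zeta + delta)^-1 < limn S by rewrite ltrBlDr ltrDl invr_gt0.
  move=> /(cvgr_gt _ lsum)[N _ HN].
  by exists N; apply: HN => /=.
have [k Hk] : exists k, lambda N < zeta * lambda k.
  have /(cvgr_lt _ (cvg_series_cvg_0 lsum))[k _ Hk] : 0 < zeta / lambda N.
    by rewrite divr_gt0.
  exists k; have := Hk k (leqnn k).
  by rewrite /= -[(lambda k)^-1]mul1r ltr_pdivrMr// mulrAC ltr_pdivlMr// mul1r.
have ltl i j : (lambda i < lambda j) = (i < j)%N by rewrite (leW_mono lincr).
have block j i : j%:R <= lambda k ->
    lambda i = zeta * lambda k + j%:R * delta ->
    S N + j.+1%:R / ((zeta + delta) * lambda k) <= S i.+1.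
  have term j' i' : j'%:R <= lambda k ->
      lambda i' = zeta * lambda k + j'%:R * delta ->
      ((zeta + delta) * lambda k)^-1 <= (lambda i')^-1.
    move=> jk ->; rewrite lef_pV2 ?posrE ?mulr_gt0//.
      by rewrite mulrDl lerD2l mulrC ler_pM2l.
    by rewrite ltr_wpDr ?mulr_gt0// mulr_ge0// ltW.
  elim: j i => [|j IH] i jk li; rewrite SS.
    rewrite mul1r lerD ?(term 0%N)//; apply: Smono; apply: ltnW.
    by rewrite -ltl li mul0r addr0.
  have jk' : j%:R <= lambda k by apply: le_trans jk; rewrite ler_nat.
  have [i' _ li'] := H k j jk'.
  rewrite -natr1 mulrDl mul1r addrA lerD ?(term j.+1)//.
  apply: le_trans (IH i' jk' li') _; apply: Smono.
  by rewrite -ltl li li' ltrD2l ltr_pM2r// ltr_nat.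
have := truncn_itv (ltW (l0 k)); set m := Num.truncn _ => /andP[mk km].
have [i _ li] := H k m mk; have := block m i mk li.
have Si : S i.+1 <= limn S by exact: nondecreasing_cvgn_le.
have dens : (zeta + delta)^-1 <= m.+1%:R / ((zeta + delta) * lambda k).
  by rewrite invfM mulrCA ler_peMr ?invr_ge0 ?(ltW zd0)// ler_pdivlMr// mul1r ltW.
by lra.
Qed.

Theorem theorem2p8 (R : realType) (p : R) (lambda : nat -> R)
    (alpha beta zeta1 zeta2 : R)
    (hp : 1 <= p)
    (lambda_gt0 : forall k, 0 < lambda k)
    (lambda_incr : increasing_seq lambda)
    (lambda_sum : cvgn (series (fun k => (lambda k)^-1)))
    (lambda_gap : 0 < inf (range (fun k => lambda k.+1 - lambda k)))
    (alpha_neq0 : alpha != 0) (beta_neq0 : beta != 0)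
    (zeta1_gt0 : 0 < zeta1) (zeta2_gt0 : 0 < zeta2) (zeta12 : zeta1 < zeta2) :
  let phi := fun x : R => alpha * x `^ zeta1 + beta * x `^ zeta2 in
  phi @` `[0, 1] `<=` `[0, 1] ->
  comp_op_not_stable p (range lambda) phi.
Proof.
move=> phi phi01.
have phi_ge0 x : 0 <= x <= 1 -> 0 <= phi x.
  move=> x01; have /= := phi01 (phi x) (ex_intro2 _ _ x _ erefl).
  by rewrite /= !in_itv/= => /(_ x01)/andP[].
have alpha0 : 0 < alpha.
  apply: (binomial_map_lead_gt0 alpha beta zeta1 zeta2) => // x /andP[x0 x1].
  by apply: phi_ge0; rewrite ltW.
have d0 : 0 < zeta2 - zeta1 by rewrite subr_gt0.
apply: contrapT => stable.
apply: (progressions_not_summable lambda zeta1 (zeta2 - zeta1)) => // k.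
have F_muntz : muntz_space p (range lambda)
    (comp_op phi (fun x => x `^ lambda k)).
  apply: contrapT => nF; apply: stable; exists (fun x => x `^ lambda k).
  split => //; first by apply: monomial_muntz => //; exists k.
  have sub : (`[0, 1[ : set R) `<=` `[0, 1].
    by apply: subset_itvl; rewrite bnd_simp.
  exact: (continuous_subspaceW sub (powR_continuous_within _ _ _ _)).
elim/ltn_ind => j IH jk; apply: contrapT => Nj.
have [r0 r00 [C HC]] :=
  binomial_map_power_expansion alpha beta zeta1 zeta2 (lambda k) j.+1
    alpha0 beta_neq0 zeta12.
have below i : (i < j)%N ->
    range lambda (zeta1 * lambda k + i%:R * (zeta2 - zeta1)).
  by move=> ij; apply: IH => //; apply: le_trans jk; rewrite ler_nat ltnW.
have exp_gt0 : 0 < zeta1 * lambda k + j%:R * (zeta2 - zeta1).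
  by rewrite ltr_wpDr ?mulr_gt0// mulr_ge0// ltW.
have exp_lt : zeta1 * lambda k + j%:R * (zeta2 - zeta1) <
    zeta1 * lambda k + j.+1%:R * (zeta2 - zeta1).
  by rewrite ltrD2l ltr_pM2r// ltr_nat.
have := muntz_leading_coef p lambda _ j
  (fun i => alpha `^ lambda k * gbinom (lambda k) i * (beta / alpha) ^+ i)
  (fun i => zeta1 * lambda k + i%:R * (zeta2 - zeta1)) C _ r0
  hp lambda_gt0 lambda_sum F_muntz below Nj exp_gt0 exp_lt r00 HC.
apply/eqP; rewrite !mulf_neq0 ?expf_neq0 ?mulf_neq0 ?invr_eq0//.
  by rewrite gt_eqF// powR_gt0.
by rewrite gt_eqF// gbinom_gt0// (le_lt_trans jk)// ltrDl.
Qed.
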